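(* Let $I\subset\mathbb{R}$ be an interval, let $(\boldsymbol{\gamma},\boldsymbol{\nu}_1,\boldsymbol{\nu}_2):I\to\mathbb{R}^3\times\Delta$ be a framed curve with unit tangent vector $\boldsymbol{\mu}=\boldsymbol{\nu}_1\times\boldsymbol{\nu}_2$, let $\{\boldsymbol{v},\boldsymbol{w},\boldsymbol{\mu}\}$ be a rotated frame along $\boldsymbol{\gamma}$, and let $(\overline{\ell},\overline{m},\overline{n},\alpha)$ be the curvature of the framed curve $(\boldsymbol{\gamma},\boldsymbol{v},\boldsymbol{w})$. Let $NS_{\boldsymbol{\gamma}}[\boldsymbol{v}]:I\times\mathbb{R}\to\mathbb{R}^3$, $NS_{\boldsymbol{\gamma}}[\boldsymbol{v}](t,\lambda)=\boldsymbol{\gamma}(t)+\lambda\boldsymbol{v}(t)$. Then there exists a smooth map $\boldsymbol{n}:I\times\mathbb{R}\to S^2$ such that $(NS_{\boldsymbol{\gamma}}[\boldsymbol{v}],\boldsymbol{n},\boldsymbol{v}):I\times\mathbb{R}\to\mathbb{R}^3\times\Delta$ is a framed surface if and only if there exists a smooth function $\varphi:I\times\mathbb{R}\to\mathbb{R}$ such that $$\lambda\overline{\ell}(t)\cos\varphi(t,\lambda)-\{\alpha(t)+\lambda\overline{m}(t)\}\sin\varphi(t,\lambda)=0$$ for all $(t,\lambda)\in I\times\mathbb{R}$.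
   Context: All maps are of class $C^\infty$. $S^2$ is the unit sphere in Euclidean space $\mathbb{R}^3$ and $\Delta=\{(\boldsymbol{x},\boldsymbol{y})\in S^2\times S^2\mid \boldsymbol{x}\cdot\boldsymbol{y}=0\}$. Framed curve: a smooth map $(\boldsymbol{\gamma},\boldsymbol{\nu}_1,\boldsymbol{\nu}_2):I\to\mathbb{R}^3\times\Delta$ with $\dot{\boldsymbol{\gamma}}(t)\cdot\boldsymbol{\nu}_1(t)=\dot{\boldsymbol{\gamma}}(t)\cdot\boldsymbol{\nu}_2(t)=0$ for all $t\in I$. Its unit tangent vector is $\boldsymbol{\mu}=\boldsymbol{\nu}_1\times\boldsymbol{\nu}_2$, and its curvature is $(\ell,m,n,\alpha)$ with $\ell=\dot{\boldsymbol{\nu}}_1\cdot\boldsymbol{\nu}_2$, $m=\dot{\boldsymbol{\nu}}_1\cdot\boldsymbol{\mu}$, $n=\dot{\boldsymbol{\nu}}_2\cdot\boldsymbol{\mu}$, $\alpha=\dot{\boldsymbol{\gamma}}\cdot\boldsymbol{\mu}$ (so $\dot{\boldsymbol{\gamma}}=\alpha\boldsymbol{\mu}$). Rotated frame: for a smooth function $\theta:I\to\mathbb{R}$ put $\boldsymbol{v}=\cos\theta\,\boldsymbol{\nu}_1-\sin\theta\,\boldsymbol{\nu}_2$ and $\boldsymbol{w}=\sin\theta\,\boldsymbol{\nu}_1+\cos\theta\,\boldsymbol{\nu}_2$; then $(\boldsymbol{\gamma},\boldsymbol{v},\boldsymbol{w})$ is a framed curve with unit tangent vector $\boldsymbol{v}\times\boldsymbol{w}=\boldsymbol{\mu}$,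 and $\{\boldsymbol{v},\boldsymbol{w},\boldsymbol{\mu}\}$ is called a rotated frame. Its curvature is $(\overline{\ell},\overline{m},\overline{n},\alpha)$ with $\overline{\ell}=\dot{\boldsymbol{v}}\cdot\boldsymbol{w}=\ell-\dot\theta$, $\overline{m}=\dot{\boldsymbol{v}}\cdot\boldsymbol{\mu}=m\cos\theta-n\sin\theta$, $\overline{n}=\dot{\boldsymbol{w}}\cdot\boldsymbol{\mu}=m\sin\theta+n\cos\theta$. Framed surface: a smooth map $(\boldsymbol{x},\boldsymbol{n},\boldsymbol{s}):U\to\mathbb{R}^3\times\Delta$ on a simply connected domain $U$ of the plane such that $\boldsymbol{x}_{u}\cdot\boldsymbol{n}=0$ and $\boldsymbol{x}_{v}\cdot\boldsymbol{n}=0$ on $U$ (subscripts denote the two partial derivatives). In $(NS_{\boldsymbol{\gamma}}[\boldsymbol{v}],\boldsymbol{n},\boldsymbol{v})$ the last component is $(t,\lambda)\mapsto\boldsymbol{v}(t)$. *)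

(* Defs.v *)
From HB Require Import structures.
From mathcomp Require Import all_boot all_order all_algebra.
From mathcomp Require Import all_classical all_reals all_analysis.
Set Implicit Arguments.
Unset Strict Implicit.
Unset Printing Implicit Defensive.
Import Order.TTheory GRing.Theory Num.Theory.
Import numFieldNormedType.Exports.
Local Open Scope classical_set_scope.
Local Open Scope ring_scope.

(* Maps defined on a subset A of a normed space V are represented by total
   functions on V; only their values on A matter.  The notions below differ
   from the library's derivable and 'D_v f in that the increments keep the
   argument inside A.  At interior points of A they coincide with them; at an
   endpoint of an interval they are one-sided. *)
Section Smooth.
Context {R : realType} {V W : normedModType R}.

Definition diff_quot (f : V -> W) (a v : V) (h : R) : W :=
  h^-1 *: (f (h *: v + a) - f a).

Definition derivable_within (A : set V) (f : V -> W) (a v : V) : Prop :=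
  cvg (diff_quot f a v @ within [set h | A (h *: v + a)] 0^').

Definition derive_within (A : set V) (f : V -> W) (a v : V) : W :=
  lim (diff_quot f a v @ within [set h | A (h *: v + a)] 0^').

(* f is of class C^k on A: the iterated partial derivatives up to order k
   along the coordinate directions listed in E exist and are continuous. *)
Fixpoint Ck_on (k : nat) (E : seq V) (A : set V) (f : V -> W) : Prop :=
  {within A, continuous f} /\
  if k is k'.+1 then
    forall e, e \in E ->
      (forall a, A a -> derivable_within A f a e) /\
      Ck_on k' E A (fun a => derive_within A f a e)
  else True.

End Smooth.

Section FramedCurvesAndSurfaces.
Context {R : realType}.
Local Notation vec := 'rV[R]_3.

Definition smooth1 {W : normedModType R} (I : set R) (f : R -> W) : Prop :=
  forall k, Ck_on k [:: 1 : R] I f.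

Definition e_1 : R * R := (1, 0).
Definition e_2 : R * R := (0, 1).

Definition smooth2 {W : normedModType R} (U : set (R * R)) (f : R * R -> W) :
  Prop := forall k, Ck_on k [:: e_1; e_2] U f.

Definition deriv1 (I : set R) (f : R -> vec) (t : R) : vec :=
  derive_within I f t (1 : R).

Definition dot (x y : vec) : R := \sum_(i < 3) x 0 i * y 0 i.

Definition vec3 (a b c : R) : vec := \row_i [:: a; b; c]`_i.

Definition cross (x y : vec) : vec :=
  let x1 := x 0 0 in let x2 := x 0 1 in let x3 := x 0 2 in
  let y1 := y 0 0 in let y2 := y 0 1 in let y3 := y 0 2 in
  vec3 (x2 * y3 - x3 * y2) (x3 * y1 - x1 * y3) (x1 * y2 - x2 * y1).

Definition sphere2 : set vec := [set x | dot x x = 1].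

Definition Delta : set (vec * vec) :=
  [set p | [/\ sphere2 p.1, sphere2 p.2 & dot p.1 p.2 = 0]].

Definition framed_curve (I : set R) (gamma nu1 nu2 : R -> vec) : Prop :=
  [/\ smooth1 I gamma, smooth1 I nu1, smooth1 I nu2,
      forall t, I t -> Delta (nu1 t, nu2 t) &
      forall t, I t -> dot (deriv1 I gamma t) (nu1 t) = 0 /\
                       dot (deriv1 I gamma t) (nu2 t) = 0].

Definition unit_tangent (nu1 nu2 : R -> vec) (t : R) : vec :=
  cross (nu1 t) (nu2 t).

Definition is_curvature (I : set R) (gamma nu1 nu2 : R -> vec)
    (l m n alpha : R -> R) : Prop :=
  forall t, I t ->
    [/\ l t = dot (deriv1 I nu1 t) (nu2 t),
        m t = dot (deriv1 I nu1 t) (unit_tangent nu1 nu2 t),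
        n t = dot (deriv1 I nu2 t) (unit_tangent nu1 nu2 t) &
        alpha t = dot (deriv1 I gamma t) (unit_tangent nu1 nu2 t)].

(* {v, w, mu} is a rotated frame along a curve framed by (nu1, nu2), where
   mu is the unit tangent vector. *)
Definition rotated_frame (I : set R) (nu1 nu2 v w mu : R -> vec) : Prop :=
  (exists2 theta : R -> R, smooth1 I theta &
    forall t, I t ->
      v t = cos (theta t) *: nu1 t - sin (theta t) *: nu2 t /\
      w t = sin (theta t) *: nu1 t + cos (theta t) *: nu2 t) /\
  (forall t, I t -> mu t = unit_tangent nu1 nu2 t).

(* The requirement that U be a simply connected domain is a condition on U
   alone and is left to the user of the definition. *)
Definition framed_surface (U : set (R * R)) (x n s : R * R -> vec) : Prop :=
  [/\ smooth2 U x, smooth2 U n, smooth2 U s,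
      forall p, U p -> Delta (n p, s p) &
      forall p, U p -> dot (derive_within U x p e_1) (n p) = 0 /\
                       dot (derive_within U x p e_2) (n p) = 0].

Definition normal_surface (gamma v : R -> vec) (p : R * R) : vec :=
  gamma p.1 + p.2 *: v p.1.

End FramedCurvesAndSurfaces.

(* Main.v *)
Require Import Defs.
From HB Require Import structures.
From mathcomp Require Import all_boot all_order all_algebra.
From mathcomp Require Import all_classical all_reals all_analysis.
From mathcomp Require Import ring lra.
Set Implicit Arguments.
Unset Strict Implicit.
Unset Printing Implicit Defensive.
Import Order.TTheory GRing.Theory Num.Theory.
Import numFieldNormedType.Exports.
Local Open Scope classical_set_scope.
Local Open Scope ring_scope.

(** A unit normal [n] of the normal surface must be orthogonal to the
    [lambda]-derivative [v] of the parametrization, hence it lies in the plane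
    spanned by the orthonormal pair [w], [mu = v x w].  Writing
    [n = cos phi w - sin phi mu], orthogonality to the [t]-derivative
    [gamma' + lambda v'] is the equation of the statement, because
    [gamma'.w = 0], [gamma'.mu = alpha], [v'.w = lbar] and [v'.mu = mbar].
    So a smooth [phi] gives a smooth [n] at once.  The content of the converse
    is that the smooth unit vector [(n.w, -n.mu)] of the plane is
    [(cos phi, sin phi)] for a smooth global angle [phi].

    This is done in two independent steps.  A continuous angle exists because
    the domain [I x R] is star-shaped ([circle_lift]): the angle at [p] is the
    sum of the small signed angles along a fine subdivision of the segment from
    the base point to [p].  Compactness of the segment makes one subdivision
    work for all points near [p], whence continuity.  Then any continuous angle
    of a smooth unit vector [(a, b)] is smooth ([Ck_angle]): along each
    coordinate direction it has the derivative [a b' - b a'], which is as smooth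
    as [a] and [b] are.

    Differentiation relative to a set is handled through the relation
    [has_deriv]; it determines [derive_within] as soon as the admissible
    increments accumulate at 0 ([admissible]), which holds at every point of a
    nondegenerate interval, endpoints included. *)

(** * Derivatives relative to a set *)

Definition steps {R : realType} {V : normedModType R} (A : set V) (a e : V) :
  set_system R := within [set h | A (h *: e + a)] 0^'.

(** The relational form of [derive_within]: limits are computed on it freely,
    and properness of [steps] is needed only to return to the operator. *)
Definition has_deriv {R : realType} {V W : normedModType R} (A : set V)
  (f : V -> W) (a e : V) (d : W) : Prop := diff_quot f a e @ steps A a e --> d.

Definition admissible {R : realType} {V : normedModType R} (A : set V)
    (E : seq V) : Prop :=
  forall e a, e \in E -> A a -> ProperFilter (steps A a e).

#[global] Instance steps_filter {R : realType} {V : normedModType R}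
  (A : set V) (a e : V) : Filter (steps A a e).
Proof. exact: within_filter. Qed.

Section Calculus.
Context {R : realType} {V : normedModType R}.
Implicit Types (A : set V) (W : normedModType R) (E : seq V).

Lemma steps_in A a e : \forall h \near steps A a e, A (h *: e + a).
Proof. by apply: withinT. Qed.

Lemma steps_neq0 A a e : \forall h \near steps A a e, h != 0.
Proof. by apply: cvg_within; exact: (@nbhs_dnbhs_neq R^o 0). Qed.

Lemma steps_cvg0 A a e : (fun h => h) @ steps A a e --> (0 : R).
Proof.
move=> B nB; apply: cvg_within; exact: (@nbhs_dnbhs R^o).
Qed.

Lemma cvg_steps A a e : (fun h => h *: e + a) @ steps A a e --> within A (nbhs a).
Proof.
move=> B /= nB.
have: (fun h : R => h *: e + a) @ steps A a e --> a.
  have := cvgD (cvgZr_tmp (a := e) (@steps_cvg0 A a e)) (cvg_cst a).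
  by rewrite scale0r add0r => H; exact: H.
move=> /(_ _ nB); apply: filterS2 (steps_in A a e) => h.
by move=> /= Ah; apply.
Qed.

Lemma has_deriv_derive A W (f : V -> W) a e :
  derivable_within A f a e -> has_deriv A f a e (derive_within A f a e).
Proof. by []. Qed.

Lemma has_deriv_val A W (f : V -> W) a e d : ProperFilter (steps A a e) ->
  has_deriv A f a e d -> derivable_within A f a e /\ derive_within A f a e = d.
Proof.
move=> P fd; split; first by apply/cvg_ex; exists d.
by apply: cvg_lim => //; exact: norm_hausdorff.
Qed.

Lemma has_deriv_eq A W (f g : V -> W) a e d : A a -> (forall x, A x -> f x = g x) ->
  has_deriv A f a e d -> has_deriv A g a e d.
Proof.
move=> Aa fg; apply: cvg_trans; apply: near_eq_cvg.
by near do rewrite /diff_quot !fg //; exact: steps_in.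
Unshelve. all: by end_near. Qed.

Lemma has_deriv_cvg A W (f : V -> W) a e d : A a -> has_deriv A f a e d ->
  (fun h => f (h *: e + a)) @ steps A a e --> f a.
Proof.
move=> Aa fd.
have := cvgD (cvgZ (@steps_cvg0 A a e) fd) (cvg_cst (f a)).
rewrite scale0r add0r => H; apply: cvg_trans (H _ _ _); apply: near_eq_cvg.
near=> h.
have hn : h != 0 by near: h; exact: steps_neq0.
by rewrite addrfctE /diff_quot /= scalerA mulfV // scale1r subrK.
Unshelve. all: by end_near. Qed.

Lemma has_deriv_cst A W (c : W) a e : has_deriv A (fun=> c) a e 0.
Proof.
have H : (fun=> 0) @ steps A a e --> (0 : W) by exact: cvg_cst.
apply: cvg_trans H; apply: near_eq_cvg; apply: nearW => h.
by rewrite /diff_quot subrr scaler0.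
Qed.

Lemma has_derivD A W (f g : V -> W) a e df dg :
  has_deriv A f a e df -> has_deriv A g a e dg ->
  has_deriv A (fun x => f x + g x) a e (df + dg).
Proof.
move=> fd gd; have := cvgD fd gd => H; apply: cvg_trans; last exact: H.
apply: near_eq_cvg; apply: nearW => h.
by rewrite addrfctE /diff_quot -scalerDr opprD addrACA.
Qed.

Lemma has_derivZ A W (g : V -> R) (f : V -> W) a e dg df : A a ->
  has_deriv A g a e dg -> has_deriv A f a e df ->
  has_deriv A (fun x => g x *: f x) a e (dg *: f a + g a *: df).
Proof.
move=> Aa gd fd.
have H1 := cvgZ gd (has_deriv_cvg Aa fd).
have H2 := cvgZ (cvg_cst (g a)) fd.
have H := cvgD (H1 _) (H2 _ _); apply: cvg_trans; last exact: H.
apply: near_eq_cvg; apply: nearW => h.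
rewrite addrfctE /diff_quot /= -[_ *: (g _ - _)]/(h^-1 * _) -scalerA.
rewrite [X in _ + X = _]scalerA [g a * _]mulrC -scalerA -scalerDr.
congr (_ *: _).
by rewrite scalerBl scalerBr addrA subrK.
Qed.

Lemma has_deriv_lin A W W' (L : W -> W') (f : V -> W) a e d :
  linear L -> continuous L -> has_deriv A f a e d ->
  has_deriv A (fun x => L (f x)) a e (L d).
Proof.
move=> Ll cL fd.
have H := @cvg_comp _ _ _ (diff_quot f a e) L _ _ _ fd (cL d).
apply: cvg_trans; last exact: H.
apply: near_eq_cvg; apply: nearW => h /=.
by rewrite /diff_quot (GRing.scalable_linear Ll) (GRing.zmod_morphism_linear Ll).
Qed.

(** Replacing the difference quotient by a function continuous at [y] makes the
    chain rule a limit of products, with no case distinction on whether the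
    inner increment vanishes. *)
Lemma caratheodory (G : R -> R) (y d : R) : is_derive y 1 G d ->
  exists Q : R -> R, [/\ {for y, continuous Q}, Q y = d &
    forall x, G x - G y = Q x * (x - y)].
Proof.
move=> Gd; exists (fun x => if x == y then d else (x - y)^-1 * (G x - G y)).
split; last first.
- move=> x; case: eqVneq => [->|xy]; first by rewrite !subrr mulr0.
  by rewrite mulrAC mulVf ?mul1r // subr_eq0.
- by rewrite eqxx.
apply/continuous_withinNshiftx; rewrite eqxx.
have [dG <-] := Gd; apply: cvg_trans; last exact: dG.
apply: near_eq_cvg; near=> h.
have h0 : h != 0 by near: h; exact: nbhs_dnbhs_neq.
rewrite /= -[h%:A]/(h * 1) mulr1 addrK -subr_eq0 addrK (negbTE h0).
by rewrite -[_ *: _]/(_ * _).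
Unshelve. all: by end_near. Qed.

Lemma has_deriv_comp A (G : R -> R) (f : V -> R) a e d d' : A a ->
  is_derive (f a) 1 G d' -> has_deriv A f a e d ->
  has_deriv A (G \o f) a e (d' * d).
Proof.
move=> Aa /caratheodory[Q [Qc <- QE]] fd.
have H1 := @cvg_comp _ _ _ _ Q _ _ _ (has_deriv_cvg Aa fd) Qc.
have H := cvgM H1 fd; apply: cvg_trans; last exact: H.
apply: near_eq_cvg; apply: nearW => h /=.
rewrite ?mulrfctE /diff_quot /= QE.
by rewrite -![h^-1 *: _]/(h^-1 * _) mulrCA.
Qed.

(** The chain rule read backwards: where the derivative of [G] does not vanish,
    differentiability of [G \o f] descends to a continuous [f].  This is what
    turns the derivative of the sine of an angle into that of the angle. *)
Lemma has_deriv_comp_inv A (G : R -> R) (f : V -> R) a e d d' : d' != 0 ->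
  is_derive (f a) 1 G d' -> (fun h => f (h *: e + a)) @ steps A a e --> f a ->
  has_deriv A (G \o f) a e (d' * d) -> has_deriv A f a e d.
Proof.
move=> d'0 /caratheodory[Q [Qc Qd QE]] fc fd.
have H1 := @cvg_comp _ _ _ _ Q _ _ _ fc Qc.
have Q0 : Q (f a) != 0 by rewrite Qd.
have H := cvgM (cvgV Q0 H1) fd.
have := H _ _; rewrite {H} Qd mulKf // => H; apply: cvg_trans; last exact: H.
apply: near_eq_cvg; near=> h.
rewrite ?mulrfctE /diff_quot /= QE.
rewrite -![h^-1 *: _]/(h^-1 * _) mulrCA mulKf //.
near: h.
exact: (cvgr_neq0 _ H1).
Unshelve. all: by end_near. Qed.

End Calculus.

(** * Maps of class C^k on a set *)

Section Ck.
Context {R : realType} {V : normedModType R} (E : seq V) (A : set V).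
Hypothesis AE : admissible A E.
Implicit Types W : normedModType R.

Lemma Ck_continuous W k (f : V -> W) : Ck_on k E A f -> {within A, continuous f}.
Proof. by case: k => [|k] []. Qed.

Lemma within_continuous_eq W (f g : V -> W) : (forall x, A x -> f x = g x) ->
  {within A, continuous f} -> {within A, continuous g}.
Proof.
move=> fg /subspace_continuousP fc; apply/subspace_continuousP => x Ax.
have := fc _ Ax; rewrite [X in _ --> X]fg //; apply: cvg_trans; apply: near_eq_cvg.
by apply: filterS (withinT A _) => y Ay; exact: fg.
Qed.

Lemma Ck_eq W k (f g : V -> W) : (forall x, A x -> f x = g x) ->
  Ck_on k E A f -> Ck_on k E A g.
Proof.
elim: k f g => [|k IH] f g fg [fc fk]; split=> //;
  try exact: within_continuous_eq fg fc.
move=> e eE; have [fd fek] := fk e eE.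
have gd a : A a -> derivable_within A g a e /\
    derive_within A g a e = derive_within A f a e.
  move=> Aa; apply: has_deriv_val; first exact: AE.
  exact: has_deriv_eq Aa fg (has_deriv_derive (fd a Aa)).
split=> [a Aa|]; first by have [] := gd a Aa.
by apply: IH fek => a Aa; have [] := gd a Aa.
Qed.

(** Together with [CkS_deriv], this lets every closure property be proved by
    exhibiting a formula for the derivative, instead of computing the iterated
    [derive_within]. *)
Lemma CkS W k (f : V -> W) : {within A, continuous f} ->
  (forall e, e \in E -> exists2 g, (forall a, A a -> has_deriv A f a e (g a)) &
     Ck_on k E A g) -> Ck_on k.+1 E A f.
Proof.
move=> fc fk; split=> // e eE; have [g fg gk] := fk e eE.
have fd a (Aa : A a) := has_deriv_val (AE eE Aa) (fg a Aa).
split=> [a Aa|]; first by have [] := fd a Aa.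
by apply: Ck_eq gk => a Aa; have [] := fd a Aa.
Qed.

Lemma CkS_deriv W k (f : V -> W) e : Ck_on k.+1 E A f -> e \in E ->
  exists2 g, (forall a, A a -> has_deriv A f a e (g a)) & Ck_on k E A g.
Proof.
move=> [_ fk] eE; have [fd fek] := fk e eE.
by exists (fun a => derive_within A f a e) => // a Aa; exact: has_deriv_derive (fd a Aa).
Qed.

Lemma Ck_pred W k (f : V -> W) : Ck_on k.+1 E A f -> Ck_on k E A f.
Proof.
elim: k f => [f [] //|k IH f fk]; apply: CkS; first exact: Ck_continuous fk.
by move=> e /(CkS_deriv fk)[g fg gk]; exists g => //; exact: IH.
Qed.

Lemma Ck_cst W k (c : W) : Ck_on k E A (fun=> c).
Proof.
have cc (c' : W) : {within A, continuous (fun=> c')}.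
  by apply: continuous_subspaceT => x; exact: cvg_cst.
elim: k c => [c|k IH c]; first by [].
by apply: CkS => // e eE; exists (fun=> 0) => // a Aa; exact: has_deriv_cst.
Qed.

Lemma CkD W k (f g : V -> W) : Ck_on k E A f -> Ck_on k E A g ->
  Ck_on k E A (fun x => f x + g x).
Proof.
elim: k f g => [f g [fc _] [gc _]|k IH f g fk gk].
  by split=> // x; apply: cvgD; [exact: fc|exact: gc].
apply: CkS => [|e eE].
  by move=> x; apply: cvgD; [exact: (Ck_continuous fk)|exact: (Ck_continuous gk)].
have [df fd dfk] := CkS_deriv fk eE; have [dg gd dgk] := CkS_deriv gk eE.
exists (fun x => df x + dg x); last exact: IH.
by move=> a Aa; apply: has_derivD; [exact: fd|exact: gd].
Qed.

Lemma CkZ W k (g : V -> R) (f : V -> W) : Ck_on k E A g -> Ck_on k E A f ->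
  Ck_on k E A (fun x => g x *: f x).
Proof.
elim: k f g => [f g [gc _] [fc _]|k IH f g gk fk].
  by split=> // x; apply: cvgZ; [exact: gc|exact: fc].
apply: CkS => [|e eE].
  by move=> x; apply: cvgZ; [exact: (Ck_continuous gk)|exact: (Ck_continuous fk)].
have [df fd dfk] := CkS_deriv fk eE; have [dg gd dgk] := CkS_deriv gk eE.
exists (fun x => dg x *: f x + g x *: df x).
  by move=> a Aa; apply: has_derivZ; [|exact: gd|exact: fd].
by apply: CkD; apply: IH => //; apply: Ck_pred.
Qed.

Lemma Ck_lin W W' k (L : W -> W') (f : V -> W) : linear L -> continuous L ->
  Ck_on k E A f -> Ck_on k E A (fun x => L (f x)).
Proof.
move=> Ll Lc; elim: k f => [f [fc _]|k IH f fk].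
  by split=> // x; apply: cvg_comp; [exact: fc|exact: Lc].
apply: CkS => [|e eE].
  by move=> x; apply: cvg_comp; [exact: (Ck_continuous fk)|exact: Lc].
have [df fd dfk] := CkS_deriv fk eE.
exists (fun x => L (df x)); last exact: IH.
by move=> a Aa; apply: has_deriv_lin => //; exact: fd.
Qed.

Lemma CkM k (f g : V -> R) : Ck_on k E A f -> Ck_on k E A g ->
  Ck_on k E A (fun x => f x * g x).
Proof. exact: CkZ. Qed.

Lemma CkN W k (f : V -> W) : Ck_on k E A f -> Ck_on k E A (fun x => - f x).
Proof.
move=> fk; have := CkZ (Ck_cst k (-1 : R)) fk.
by apply: Ck_eq => x _; rewrite scaleN1r.
Qed.

Lemma CkB W k (f g : V -> W) : Ck_on k E A f -> Ck_on k E A g ->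
  Ck_on k E A (fun x => f x - g x).
Proof. by move=> fk gk; apply: CkD => //; exact: CkN. Qed.

(** Both functions at once, since each one appears in the derivative of the
    other. *)
Lemma Ck_cos_sin k (f : V -> R) : Ck_on k E A f ->
  Ck_on k E A (fun x => cos (f x)) /\ Ck_on k E A (fun x => sin (f x)).
Proof.
have cc (g : V -> R) : {within A, continuous g} ->
    {within A, continuous (fun x => cos (g x))} /\
    {within A, continuous (fun x => sin (g x))}.
  move=> gc; split=> x; apply: cvg_comp; try exact: gc.
    exact: continuous_cos.
  exact: continuous_sin.
elim: k f => [f [/cc[]]|k IH f fk]; first by split.
have [cf sf] := cc _ (Ck_continuous fk).
have [ck sk] := IH _ (Ck_pred fk).
split; apply: CkS => // e eE; have [df fd dfk] := CkS_deriv fk eE.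
- exists (fun x => - sin (f x) * df x) => [a Aa|]; last by apply: CkM => //; exact: CkN.
  exact: has_deriv_comp (is_derive_cos _) (fd a Aa).
- exists (fun x => cos (f x) * df x) => [a Aa|]; last exact: CkM.
  exact: has_deriv_comp (is_derive_sin _) (fd a Aa).
Qed.

End Ck.

(** * The product of an interval and the line *)

Section Product.
Context {R : realType} {W : normedModType R}.
Variable I : set R.
Local Notation U := (I `*` [set: R]).

Lemma steps_e_1 (p : R * R) : steps U p e_1 = steps I p.1 1.
Proof.
rewrite /steps.
suff -> : [set h : R | U (h *: e_1 + p)] = [set h | I (h *: 1 + p.1)] by [].
by apply/seteqP; split=> h /=; [case|split].
Qed.

Lemma steps_e_2 (p : R * R) : I p.1 -> steps U p e_2 = 0^'.
Proof.
move=> Ip; rewrite /steps.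
have -> : [set h : R | U (h *: e_2 + p)] = setT.
  by apply/seteqP; split=> // h _; split=> //=; rewrite -[h *: _]/(h * 0) mulr0 add0r.
exact: withinET.
Qed.

Lemma admissible_interval : is_interval I -> (exists a b, [/\ I a, I b & a < b]) ->
  admissible I [:: 1].
Proof.
move=> II [x [y [Ix Iy xy]]] e t; rewrite inE => /eqP -> It.
have [s [Is st]] : exists s, I s /\ s != t.
  have [xt|xt] := eqVneq x t; last by exists x.
  by exists y; split=> //; rewrite -xt gt_eqF.
apply: Build_ProperFilter_ex => B [r /= r0 Br].
have st0 : `|s - t| > 0 by rewrite normr_gt0 subr_eq0.
have [q [q0 q1 qr]] : exists q : R, [/\ 0 < q, q <= 1 & q * `|s - t| < r].
  (* q is the fraction of the way from t to s, capped at 1 to remain in I. *)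
  exists (Num.min 1 (r / 2 / `|s - t|)); rewrite lt_min ltr01 !divr_gt0 // ge_min lexx.
  split=> //; rewrite -ltr_pdivlMr // gt_min ltr_pM2r ?invr_gt0 //.
  by rewrite ltr_pdivrMr // ltr_pMr // ltr1n orbT.
have q0' : q != 0 by rewrite gt_eqF.
exists (q * (s - t)); apply: Br => /=.
- by rewrite sub0r normrN normrM gtr0_norm.
- by rewrite mulf_neq0 // subr_eq0.
- rewrite -[_ *: _]/(_ * 1) mulr1.
  case: (ltgtP s t) st => // st _; [apply: (II s t)|apply: (II t s)] => //.
  + by apply/andP; split; nra.
  + by apply/andP; split; nra.
Qed.

Lemma admissible_product : admissible I [:: 1] -> admissible U [:: e_1; e_2].
Proof.
move=> IE e p; rewrite !inE => /orP[]/eqP -> [/= Ip _].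
  by rewrite steps_e_1; apply: IE => //; rewrite inE.
by rewrite steps_e_2 //; exact: Proper_dnbhs_numFieldType.
Qed.

Hypothesis IE : admissible I [:: 1].

Lemma has_deriv_fst (f : R -> W) p d : has_deriv I f p.1 1 d ->
  has_deriv U (fun p => f p.1) p e_1 d.
Proof. by rewrite /has_deriv steps_e_1. Qed.

Lemma has_deriv_fst_e_2 (f : R -> W) p : has_deriv U (fun p => f p.1) p e_2 0.
Proof.
have H : (fun=> 0) @ steps U p e_2 --> (0 : W) by exact: cvg_cst.
apply: cvg_trans; last exact: H.
apply: near_eq_cvg; apply: nearW => h; rewrite /diff_quot /=.
by rewrite -[h *: (0 : R)]/(h * 0) mulr0 add0r subrr scaler0.
Qed.

Lemma Ck_fst k (f : R -> W) : Ck_on k [:: 1 : R] I f ->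
  Ck_on k [:: e_1; e_2] U (fun p => f p.1).
Proof.
have fstc (g : R -> W) : {within I, continuous g} ->
    {within U, continuous (fun p => g p.1)}.
  move=> /subspace_continuousP gc; apply/subspace_continuousP => p [Ip _].
  apply: (@cvg_comp _ _ _ fst g _ (within I (nbhs p.1))); last exact: gc.
  move=> B /= nB; have pF : Filter (nbhs p) by exact: nbhs_filter.
  have nB1 := @cvg_fst _ _ (nbhs p.1) (nbhs p.2) (nbhs_filter _) _ nB.
  by apply: (@filterS _ _ pF _ _ _ nB1) => q qB [Iq _]; exact: qB.
have UE := admissible_product IE.
elim: k f => [f [fc _]|k IH f fk]; first by split=> //; exact: fstc.
apply: (CkS UE) => [|e]; first exact: fstc (Ck_continuous fk).
rewrite !inE => /orP[]/eqP ->.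
  have [g fg gk] := CkS_deriv fk (mem_head _ _).
  exists (fun p => g p.1); last exact: IH.
  by move=> p [Ip _]; apply: has_deriv_fst; exact: fg.
exists (fun=> 0); last exact: Ck_cst.
by move=> p _; exact: has_deriv_fst_e_2.
Qed.

Lemma has_deriv_snd_e_1 p : has_deriv U snd p e_1 0.
Proof.
have H : (fun=> 0) @ steps U p e_1 --> (0 : R) by exact: cvg_cst.
apply: cvg_trans; last exact: H.
apply: near_eq_cvg; apply: nearW => h; rewrite /diff_quot /=.
by rewrite -[h *: 0]/(h * 0) mulr0 add0r subrr scaler0.
Qed.

Lemma has_deriv_snd_e_2 p : has_deriv U snd p e_2 1.
Proof.
have H : (fun=> 1) @ steps U p e_2 --> (1 : R) by exact: cvg_cst.
apply: cvg_trans; last exact: H.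
apply: near_eq_cvg; near=> h; rewrite /diff_quot /=.
have h0 : h != 0 by near: h; exact: steps_neq0.
by rewrite addrK -[h *: 1]/(h * 1) mulr1 -[_ *: _]/(_ * _) mulVf.
Unshelve. all: by end_near. Qed.

Lemma Ck_snd k : Ck_on k [:: e_1; e_2] U (snd : R * R -> R).
Proof.
have sc : {within U, continuous (snd : R * R -> R)}.
  by apply: continuous_subspaceT => p; exact: cvg_snd.
have UE := admissible_product IE.
case: k => [//|k]; apply: (CkS UE) => // e; rewrite !inE => /orP[]/eqP ->.
- by exists (fun=> 0); [move=> p _; exact: has_deriv_snd_e_1|exact: Ck_cst].
- by exists (fun=> 1); [move=> p _; exact: has_deriv_snd_e_2|exact: Ck_cst].
Qed.

End Product.

(** * Smoothness of a continuous angle *)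

Section Angle.
Context {R : realType} {V : normedModType R} (E : seq V) (A : set V).
Hypothesis AE : admissible A E.

(** The increment [delta] of the angle satisfies
    [sin delta = a(x) b(y) - b(x) a(y)], whose right-hand side is differentiable
    in [y].  Continuity gives [delta -> 0], where the sine is invertible with
    derivative 1, so [delta] itself has the derivative of that expression. *)
Lemma has_deriv_angle (a b phi : V -> R) x e da db : A x ->
  {within A, continuous phi} ->
  (forall y, A y -> cos (phi y) = a y /\ sin (phi y) = b y) ->
  has_deriv A a x e da -> has_deriv A b x e db ->
  has_deriv A phi x e (a x * db - b x * da).
Proof.
move=> Ax /subspace_continuousP phic ab ad bd.
have cx : has_deriv A (fun=> phi x) x e 0 := has_deriv_cst A (phi x) x e.
suff phid : has_deriv A (fun y => phi y - phi x) x e (a x * db - b x * da).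
  have := has_derivD phid cx; rewrite addr0.
  by apply: has_deriv_eq => // y _; rewrite subrK.
have sd : has_deriv A (fun y => sin (phi y - phi x)) x e (1 * (a x * db - b x * da)).
  have cd c : has_deriv A (fun=> c : R) x e 0 := has_deriv_cst A c x e.
  have := has_derivD (has_derivZ Ax (cd (a x)) bd) (has_derivZ Ax (cd (- b x)) ad).
  rewrite !scale0r !add0r mul1r -mulNr.
  apply: has_deriv_eq => // y Ay.
  have [<- <-] := ab _ Ax; have [<- <-] := ab _ Ay.
  by rewrite sinB -[_ *: sin _]/(_ * _) -[_ *: cos _]/(_ * _); ring.
apply: has_deriv_comp_inv sd => //.
- by have := is_derive_sin (phi x - phi x); rewrite subrr cos0.
- apply: cvgB; last exact: cvg_cst.
  have := @cvg_comp _ _ _ _ phi _ _ _ (@cvg_steps _ _ A x e) (phic _ Ax).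
  exact.
Qed.

(** The derivative of an angle does not involve the angle itself, so no
    induction is needed: one more derivative of [phi] costs one derivative of
    [a] and [b]. *)
Lemma Ck_angle (a b phi : V -> R) :
  {within A, continuous phi} ->
  (forall y, A y -> cos (phi y) = a y /\ sin (phi y) = b y) ->
  (forall k, Ck_on k E A a) -> (forall k, Ck_on k E A b) ->
  forall k, Ck_on k E A phi.
Proof.
move=> phic ab ak bk [//|k]; apply: CkS => // e eE.
have [da ad dak] := CkS_deriv (ak k.+1) eE.
have [db bd dbk] := CkS_deriv (bk k.+1) eE.
exists (fun x => a x * db x - b x * da x).
  by move=> x Ax; apply: has_deriv_angle => //; [exact: ad|exact: bd].
by apply: CkB => //; apply: CkM.
Qed.

End Angle.

(** * Continuous angles on star-shaped sets *)

Section CircleLift.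
Context {R : realType} {V : normedModType R} (A : set V) (p0 : V) (a b : V -> R).

Definition ray (s : R) (p : V) : V := p0 + s *: (p - p0).

Hypothesis A_star : forall p s, A p -> 0 <= s <= 1 -> A (ray s p).
Hypothesis a_cont : {within A, continuous a}.
Hypothesis b_cont : {within A, continuous b}.
Hypothesis ab1 : forall p, A p -> a p ^+ 2 + b p ^+ 2 = 1.

(** [cosang x y] and [sinang x y] are the cosine and the sine of the angle from
    the unit vector [(a x, b x)] to the unit vector [(a y, b y)]; [arc x y] is
    that angle when the two vectors are less than a right angle apart. *)
Definition cosang (x y : V) : R := a x * a y + b x * b y.
Definition sinang (x y : V) : R := a x * b y - b x * a y.
Definition arc (x y : V) : R := asin (sinang x y).

Lemma cosang_sinang x y : A x -> A y -> cosang x y ^+ 2 + sinang x y ^+ 2 = 1.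
Proof.
move=> /ab1 x1 /ab1 y1; rewrite -[RHS]mulr1 -{1}x1 -y1 /cosang /sinang; ring.
Qed.

Lemma sinang_lt1 x y : A x -> A y -> 0 < cosang x y -> -1 < sinang x y < 1.
Proof. by move=> Ax Ay c0; have := cosang_sinang Ax Ay => cs; apply/andP; split; nra. Qed.

Lemma sinang_in x y : A x -> A y -> 0 < cosang x y -> -1 <= sinang x y <= 1.
Proof. by move=> Ax Ay /(sinang_lt1 Ax Ay)/andP[/ltW -> /ltW ->]. Qed.

Lemma sin_arc x y : A x -> A y -> 0 < cosang x y -> sin (arc x y) = sinang x y.
Proof. by move=> Ax Ay c0; rewrite asinK // in_itv /=; exact: sinang_in. Qed.

Lemma cos_arc x y : A x -> A y -> 0 < cosang x y -> cos (arc x y) = cosang x y.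
Proof.
move=> Ax Ay c0; rewrite cos_asin; last exact: sinang_in.
by rewrite -(cosang_sinang Ax Ay) addrK sqrtr_sqr gtr0_norm.
Qed.

Lemma cos_le0 (t : R) : pi / 2 <= t <= pi -> cos t <= 0.
Proof.
move=> /andP[t1 t2]; rewrite -[t](subrK (pi / 2)) cosDpihalf oppr_le0.
have := pi_gt0 R => pi0.
by apply: sin_ge0_pi; apply/andP; split; lra.
Qed.

(** Angles always add up modulo a full turn.  The sum here lies in
    [(-pi, pi)] and has positive cosine, hence it lies in [(-pi/2, pi/2)], where
    it is recovered from its sine. *)
Lemma arcD x y z : A x -> A y -> A z ->
  0 < cosang x y -> 0 < cosang y z -> 0 < cosang x z ->
  arc x z = arc x y + arc y z.
Proof.
move=> Ax Ay Az xy yz xz.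
have /andP[xy1 xy2] := sinang_lt1 Ax Ay xy; have /andP[yz1 yz2] := sinang_lt1 Ay Az yz.
have lo1 : - (pi / 2) < arc x y by apply: asin_gtNpi2; rewrite xy1 ltW.
have lo2 : - (pi / 2) < arc y z by apply: asin_gtNpi2; rewrite yz1 ltW.
have hi1 : arc x y < pi / 2 by apply: asin_ltpi2; rewrite xy2 ltW.
have hi2 : arc y z < pi / 2 by apply: asin_ltpi2; rewrite yz2 ltW.
have := ab1 Ay => y1.
have cE : cos (arc x y + arc y z) = cosang x z.
  rewrite cosD !cos_arc // !sin_arc // -[RHS]mul1r -y1 /cosang /sinang; ring.
have sE : sin (arc x y + arc y z) = sinang x z.
  rewrite sinD !cos_arc // !sin_arc // -[RHS]mul1r -y1 /cosang /sinang; ring.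
rewrite {1}/arc -sE sinK // in_itv /=.
apply/andP; split; rewrite leNgt; apply/negP => lt.
- have : cos (- (arc x y + arc y z)) <= 0 by apply: cos_le0; apply/andP; split; lra.
  by rewrite cosN cE; lra.
- have : cos (arc x y + arc y z) <= 0 by apply: cos_le0; apply/andP; split; lra.
  by rewrite cE; lra.
Qed.

(** Any two points of the segment at parameter distance at most [2^-k] are less
    than a right angle apart; asking this of all such pairs, and not only of
    consecutive nodes, makes the condition pass to finer subdivisions. *)
Definition fine_on (k : nat) (p : V) : Prop := forall s s' : R,
  0 <= s <= 1 -> 0 <= s' <= 1 -> `|s - s'| <= (2 ^+ k)^-1 ->
  0 < cosang (ray s p) (ray s' p).

Definition node (k j : nat) (p : V) : V := ray (j%:R / 2 ^+ k) p.

Definition total_arc (k : nat) (p : V) : R :=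
  \sum_(0 <= j < 2 ^ k) arc (node k j p) (node k j.+1 p).

Lemma node_param k j : (j <= 2 ^ k)%N -> 0 <= (j%:R / 2 ^+ k : R) <= 1.
Proof.
move=> jk; rewrite divr_ge0 ?exprn_ge0 //= ler_pdivrMr ?exprn_gt0 // mul1r.
by rewrite -natrX ler_nat.
Qed.

Lemma node_in k j p : A p -> (j <= 2 ^ k)%N -> A (node k j p).
Proof. by move=> Ap /node_param; exact: A_star. Qed.

Lemma node_step k j : `|j%:R / 2 ^+ k - j.+1%:R / 2 ^+ k| = (2 ^+ k)^-1 :> R.
Proof.
rewrite -mulrBl -[j.+1]addn1 natrD opprD addNKr mulN1r normrN.
by rewrite ger0_norm // invr_ge0 exprn_ge0.
Qed.

Lemma node_double k j p : node k.+1 j.*2 p = node k j p.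
Proof.
rewrite /node; congr ray; rewrite -mul2n natrM exprS invfM mulrACA divff ?mul1r //.
Qed.

Lemma fine_node k j p : fine_on k p -> (j < 2 ^ k)%N ->
  0 < cosang (node k j p) (node k j.+1 p).
Proof. by move=> kp jk; apply: kp; rewrite ?node_step //; apply: node_param => //; exact: ltnW. Qed.

Lemma fine_onS k p : fine_on k p -> fine_on k.+1 p.
Proof.
move=> kp s s' s01 s'01 ss'; apply: kp => //; apply: le_trans ss' _.
by rewrite lef_pV2 ?posrE ?exprn_gt0 // ler_eXn2l // ltr1n.
Qed.

(** Halving the step replaces each arc by two arcs that add up to it. *)
Lemma total_arcS k p : A p -> fine_on k p -> total_arc k.+1 p = total_arc k p.
Proof.
move=> Ap kp; have kSp := fine_onS kp; rewrite /total_arc expnS mul2n.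
have jE : forall n, (n <= 2 ^ k)%N ->
   \sum_(0 <= j < n.*2) arc (node k.+1 j p) (node k.+1 j.+1 p) =
   \sum_(0 <= j < n) arc (node k j p) (node k j.+1 p).
  elim=> [|n IH] nk; first by rewrite !big_geq.
  have n2 : (n.*2.+2 <= 2 ^ k.+1)%N by rewrite -doubleS expnS mul2n leq_double.
  rewrite doubleS !big_nat_recr //= IH 1?ltnW // -addrA; congr (_ + _).
  rewrite -(node_double k n) -(node_double k n.+1); apply/esym; apply: arcD.
  - exact: node_in (ltnW (ltnW n2)).
  - exact: node_in (ltnW n2).
  - exact: node_in.
  - exact: fine_node (ltnW n2).
  - exact: fine_node.
  - by rewrite !node_double; exact: fine_node.
exact: jE.
Qed.

Lemma total_arc_stable k m p : A p -> fine_on k p ->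
  fine_on (m + k) p /\ total_arc (m + k) p = total_arc k p.
Proof.
move=> Ap kp; elim: m => [//|m [mp mE]]; rewrite addSn; split; first exact: fine_onS.
by rewrite total_arcS.
Qed.

Lemma total_arc_unique k l p : A p -> fine_on k p -> fine_on l p ->
  total_arc k p = total_arc l p.
Proof.
move=> Ap kp lp; rewrite -(total_arc_stable l Ap kp).2 addnC.
by rewrite (total_arc_stable k Ap lp).2.
Qed.

Lemma cos_sin_total_arc k p : A p -> fine_on k p ->
  cos (total_arc k p) = cosang p0 p /\ sin (total_arc k p) = sinang p0 p.
Proof.
move=> Ap kp.
have ray0 : ray 0 p = p0 by rewrite /ray scale0r addr0.
have ray1 : ray 1 p = p by rewrite /ray scale1r addrC subrK.
have Ap0 : A p0 by rewrite -ray0; apply: A_star => //; rewrite lexx ler01.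
have H : forall n, (n <= 2 ^ k)%N ->
  let S := \sum_(0 <= j < n) arc (node k j p) (node k j.+1 p) in
  cos S = cosang p0 (node k n p) /\ sin S = sinang p0 (node k n p).
  elim=> [|n IH] nk /=.
    rewrite big_geq // cos0 sin0 /node mul0r ray0 /cosang /sinang -!expr2 ab1 //.
    by rewrite mulrC subrr.
  have [IHc IHs] := IH (ltnW nk); rewrite big_nat_recr //=.
  have An := node_in Ap (ltnW nk); have ASn := node_in Ap nk.
  have cn := fine_node kp nk; have := ab1 An => n1.
  rewrite cosD sinD IHc IHs cos_arc // sin_arc //.
  split; [rewrite -[RHS]mul1r -n1 /cosang /sinang; ring|].
  rewrite -[RHS]mul1r -n1 /cosang /sinang; ring.
have := H (2 ^ k)%N (leqnn _); rewrite /= /node natrX divff ?ray1 //.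
Qed.

Lemma ray_cvg s p : ray s q @[q --> within A (nbhs p)] --> ray s p.
Proof.
apply: cvgD; first exact: cvg_cst.
apply: cvgZl_tmp; apply: cvgB; last exact: cvg_cst.
exact: cvg_within.
Qed.

Lemma comp_ray_cvg (f : V -> R) s p : {within A, continuous f} -> A p -> 0 <= s <= 1 ->
  f (ray s q) @[q --> within A (nbhs p)] --> f (ray s p).
Proof.
move=> /subspace_continuousP fc Ap s01.
apply: (@cvg_comp _ _ _ (ray s) f _ (within A (nbhs (ray s p))));
  last exact: fc (A_star Ap s01).
move=> B /= nB.
have rayB : \forall q \near within A (nbhs p), A (ray s q) -> B (ray s q).
  exact: (@ray_cvg s p _ nB).
apply: filterS2 (withinT A _) rayB => q Aq.
by apply; exact: A_star.
Qed.

Lemma total_arc_cvg k p : A p -> fine_on k p ->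
  total_arc k q @[q --> within A (nbhs p)] --> total_arc k p.
Proof.
move=> Ap kp; rewrite /total_arc.
under eq_fun do rewrite big_nat; rewrite big_nat.
apply: cvg_big => [|j /andP[_ jk]].
  exact: add_continuous.
have s1 := node_param (ltnW jk); have s2 := node_param jk.
apply: continuous_cvg.
  apply: continuous_asin; apply: sinang_lt1.
  - exact: node_in (ltnW jk).
  - exact: node_in jk.
  - exact: fine_node.
by apply: cvgB; apply: cvgM; apply: comp_ray_cvg.
Qed.

(** Compactness of the unit segment: it suffices to find, for each parameter [s0], a
    condition near [s0] that holds for [q] near [p] and [k] large.  There both
    unit vectors involved are within 1/4, in each coordinate, of the one at
    [ray s0 p], which forces their inner product to be positive. *)
Lemma near_fine p : A p -> exists k, \forall q \near within A (nbhs p), fine_on k q.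
Proof.
move=> Ap.
pose P (qk : V * nat) (s : R) := A qk.1 -> 0 <= s <= 1 -> forall s', 0 <= s' <= 1 ->
  `|s - s'| <= (2 ^+ qk.2)^-1 -> 0 < cosang (ray s qk.1) (ray s' qk.1).
have loc (s0 : R) : s0 \in `[0, 1]%R ->
    \forall s \near s0 & qk \near filter_prod (nbhs p) \oo, P qk s.
  rewrite in_itv /= => s01; have Ar := A_star Ap s01.
  have q4 : 0 < 4^-1 :> R by rewrite invr_gt0.
  have /subspace_continuousP/(_ _ Ar) ac := a_cont.
  have /subspace_continuousP/(_ _ Ar) bc := b_cont.
  have aU : \forall r \near within A (nbhs (ray s0 p)),
      `|a r - a (ray s0 p)| < 4^-1.
    by move: q4; exact: cvgr_distC_lt ac _.
  have bU : \forall r \near within A (nbhs (ray s0 p)),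
      `|b r - b (ray s0 p)| < 4^-1.
    by move: q4; exact: cvgr_distC_lt bc _.
  have U : \forall r \near within A (nbhs (ray s0 p)),
      `|a r - a (ray s0 p)| < 4^-1 /\ `|b r - b (ray s0 p)| < 4^-1.
    by apply: filterS2 aU bU => r ar br; split.
  have rc : ray sq.1 sq.2 @[sq --> (s0, p)] --> ray s0 p.
    apply: cvgD; first exact: cvg_cst.
    apply: cvgZ; first exact: cvg_fst.
    by apply: cvgB; [exact: cvg_snd|exact: cvg_cst].
  have [[B1 B2] /= [nB1 nB2] BU] := rc _ U.
  have /nbhs_ballP[eps /= eps0 epsB] := nB1.
  have e2 : 0 < eps / 2 by rewrite divr_gt0.
  have half : `|2^-1 : R| < 1 by rewrite ger0_norm ?invr_ge0 // invf_lt1 // ltr1n.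
  have kK : \forall k \near \oo, `|2^-1 ^+ k : R| < eps / 2.
    by move: e2; exact: cvgr0_norm_lt (cvg_expr half) _.
  exists (ball s0 (eps / 2), [set qk | B2 qk.1 /\ `|2^-1 ^+ qk.2 : R| < eps / 2]) => /=.
    split; first exact: nbhsx_ballx.
    exists (B2, [set k | `|2^-1 ^+ k : R| < eps / 2]); first by split.
    by move=> [q k] [].
  move=> [s [q k]] /= [sb [qB kb]] Aq s1 s' s'1 ss'.
  have near_s0 u : 0 <= u <= 1 -> `|s0 - u| < eps ->
      `|a (ray u q) - a (ray s0 p)| < 4^-1 /\ `|b (ray u q) - b (ray s0 p)| < 4^-1.
    move=> u1 us; have := BU (u, q); apply; first by split=> //; exact: epsB.
    exact: A_star.
  have ss0 : `|s0 - s| < eps / 2 by exact: sb.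
  have s's : `|s - s'| < eps / 2.
    by apply: le_lt_trans kb; rewrite exprVn [leRHS]ger0_norm // invr_ge0 exprn_ge0.
  have [] := near_s0 s s1.
    by apply: lt_trans ss0 _; rewrite ltr_pdivrMr // ltr_pMr // ltr1n.
  rewrite !ltr_distl => /andP[a1 a2] /andP[b1 b2].
  have [] := near_s0 s' s'1.
    rewrite -[s0](subrK s) -addrA; apply: le_lt_trans (ler_normD _ _) _.
    by rewrite [eps](splitr eps) ltrD.
  rewrite !ltr_distl => /andP[a1' a2'] /andP[b1' b2'].
  have := ab1 (A_star Aq s1); have := ab1 (A_star Aq s'1).
  rewrite /cosang; nra.
have [[B K] /= [nB [N _ nK]] BK] :=
  (compact_near_coveringP `[(0 : R), 1]).1 (@segment_compact R 0 1) _ _ P _ loc.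
exists N; rewrite near_withinE; apply: filterS nB => q Bq Aq s s' s1 s'1 ss'.
have BKqN : (B `*` K) (q, N) by split=> //=; apply: nK; exact: leqnn.
by apply: (BK _ BKqN s).
Qed.

(** The angle at [p] is the common value of [total_arc k p] for all
    sufficiently large [k], added to an angle at the base point. *)
Lemma circle_lift : A p0 -> exists phi : V -> R, {within A, continuous phi} /\
  forall p, A p -> cos (phi p) = a p /\ sin (phi p) = b p.
Proof.
move=> Ap0.
have [t [tc ts]] : exists t, cos t = a p0 /\ sin t = b p0.
  have := ab1 Ap0 => ab0.
  have a1 : -1 <= a p0 <= 1 by apply/andP; split; nra.
  have sq : Num.sqrt (1 - a p0 ^+ 2) = `|b p0|.
    by rewrite -ab0 addrAC subrr add0r sqrtr_sqr.
  have [b0|b0] := leP 0 (b p0).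
    exists (acos (a p0)); rewrite acosK ?in_itv // sin_acos // sq ger0_norm //.
  exists (- acos (a p0)).
  rewrite cosN sinN acosK ?in_itv // sin_acos // sq ltr0_norm // opprK.
  by [].
(* 0 is a default value: a suitable k exists at every point of A. *)
pose L p := total_arc (xget 0%N [set k | fine_on k p]) p.
have LE k p : A p -> fine_on k p -> L p = total_arc k p.
  move=> Ap kp; apply: total_arc_unique => //.
  by have := xgetI 0%N (P := [set k | fine_on k p]) kp.
exists (fun p => t + L p); split; last first.
  move=> p Ap; have [k kp] := near_fine Ap.
  have {}kp : fine_on k p by exact: (nbhs_singleton kp) Ap.
  have [Lc Ls] := cos_sin_total_arc Ap kp.
  have := ab1 Ap0 => ab0.
  rewrite cosD sinD (LE k) // Lc Ls tc ts /cosang /sinang.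
  by split; rewrite -[RHS]mul1r -ab0; ring.
apply/subspace_continuousP => p Ap.
apply: cvgD; first exact: cvg_cst.
have [k kq] := near_fine Ap.
have kp : fine_on k p by exact: (nbhs_singleton kq) Ap.
rewrite (LE k) //; have := total_arc_cvg Ap kp.
apply: cvg_trans; apply: near_eq_cvg.
by apply: filterS2 (withinT A _) kq => q Aq kq; rewrite (LE k).
Qed.

End CircleLift.

(** * Vectors of three-space *)

Section Vectors.
Context {R : realType}.
Local Notation vec := 'rV[R]_3.
Implicit Types x y v w : vec.

Lemma dotE x y : dot x y = x 0 0 * y 0 0 + x 0 1 * y 0 1 + x 0 2 * y 0 2.
Proof.
rewrite /dot !big_ord_recl big_ord0 addr0 addrA.
by congr (_ * _ + _ * _ + _ * _); congr (_ _ _); apply: val_inj.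
Qed.

Lemma crossE x y : [/\ cross x y 0 0 = x 0 1 * y 0 2 - x 0 2 * y 0 1,
  cross x y 0 1 = x 0 2 * y 0 0 - x 0 0 * y 0 2 &
  cross x y 0 2 = x 0 0 * y 0 1 - x 0 1 * y 0 0].
Proof. by split; rewrite mxE. Qed.

Lemma vec3E (a b c : R) : vec3 a b c =
  a *: delta_mx 0 0 + b *: delta_mx 0 1 + c *: delta_mx 0 2.
Proof.
apply/rowP => i; rewrite !mxE.
by case: i => [[|[|[|//]]] ?]; rewrite /= ?mulr1 ?mulr0 ?addr0 ?add0r.
Qed.

Lemma dotC x y : dot x y = dot y x.
Proof. by rewrite !dotE; ring. Qed.

Lemma dotDl x y w : dot (x + y) w = dot x w + dot y w.
Proof. by rewrite !dotE !mxE; ring. Qed.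

Lemma dotZl (c : R) x w : dot (c *: x) w = c * dot x w.
Proof. by rewrite !dotE !mxE; ring. Qed.

Lemma dotNl x w : dot (- x) w = - dot x w.
Proof. by rewrite !dotE !mxE; ring. Qed.

Definition dot_lin := (dotDl, dotZl, dotNl).

Lemma dot_cross_l v w : dot (cross v w) v = 0.
Proof. by have [c0 c1 c2] := crossE v w; rewrite dotE c0 c1 c2; ring. Qed.

Lemma dot_cross_r v w : dot (cross v w) w = 0.
Proof. by have [c0 c1 c2] := crossE v w; rewrite dotE c0 c1 c2; ring. Qed.

(** Parseval's identity in the orthonormal frame [v], [w], [v x w].  The product
    of the two triple products is the Gram determinant of the triples
    [(x, v, w)] and [(y, v, w)], a polynomial identity; orthonormality reduces
    that determinant to [x.y - (x.v)(y.v) - (x.w)(y.w)]. *)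
Lemma dot_frame v w x y : dot v v = 1 -> dot w w = 1 -> dot v w = 0 ->
  dot x y = dot x v * dot y v + dot x w * dot y w +
            dot x (cross v w) * dot y (cross v w).
Proof.
move=> vv ww vw.
have gram : dot x (cross v w) * dot y (cross v w) =
    dot x y * (dot v v * dot w w - dot v w ^+ 2)
    - dot x v * (dot v y * dot w w - dot v w * dot w y)
    + dot x w * (dot v y * dot v w - dot v v * dot w y).
  have [c0 c1 c2] := crossE v w; rewrite !dotE c0 c1 c2; ring.
rewrite gram vv ww vw (dotC v y) (dotC w y); ring.
Qed.

Lemma dot_cross_cross v w : dot v v = 1 -> dot w w = 1 -> dot v w = 0 ->
  dot (cross v w) (cross v w) = 1.
Proof.
move=> vv ww vw.
have gram : dot (cross v w) (cross v w) = dot v v * dot w w - dot v w ^+ 2.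
  by have [c0 c1 c2] := crossE v w; rewrite !dotE c0 c1 c2; ring.
by rewrite gram vv ww vw; ring.
Qed.

Lemma Delta_rotate v w (t : R) : Delta (v, w) ->
  Delta (cos t *: v - sin t *: w, sin t *: v + cos t *: w).
Proof.
rewrite /Delta /sphere2 /=; case=> vv ww vw.
have sc := cos2Dsin2 t.
have dotE2 (a b c d : R) :
    dot (a *: v + b *: w) (c *: v + d *: w) = a * c + b * d.
  rewrite !dot_lin !(dotC _ (_ + _)) !dot_lin vv ww vw (dotC w v) vw; ring.
split; rewrite -?scaleNr dotE2 -?sc; ring.
Qed.

Context {V : normedModType R} (E : seq V) (A : set V).
Hypothesis AE : admissible A E.

Lemma Ck_coord k (f : V -> vec) (i : 'I_3) : Ck_on k E A f ->
  Ck_on k E A (fun p => f p 0 i).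
Proof.
apply: (Ck_lin AE (L := fun x : vec => x 0 i)); last exact: coord_continuous.
by move=> a x y; rewrite !mxE.
Qed.

Lemma Ck_dot k (f g : V -> vec) : Ck_on k E A f -> Ck_on k E A g ->
  Ck_on k E A (fun p => dot (f p) (g p)).
Proof.
move=> fk gk.
have H i := CkM AE (Ck_coord i fk) (Ck_coord i gk).
have := CkD AE (CkD AE (H 0) (H 1)) (H 2).
by apply: Ck_eq => // p _; rewrite dotE.
Qed.

Lemma Ck_cross k (f g : V -> vec) : Ck_on k E A f -> Ck_on k E A g ->
  Ck_on k E A (fun p => cross (f p) (g p)).
Proof.
move=> fk gk.
have H i j := CkB AE (CkM AE (Ck_coord i fk) (Ck_coord j gk))
  (CkM AE (Ck_coord j fk) (Ck_coord i gk)).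
have D (j : 'I_3) := Ck_cst AE k (delta_mx 0 j : vec).
have := CkD AE (CkD AE (CkZ AE (H 1 2) (D 0)) (CkZ AE (H 2 0) (D 1)))
  (CkZ AE (H 0 1) (D 2)).
by apply: Ck_eq => // p _; rewrite /cross vec3E.
Qed.

End Vectors.

(** * Normal surfaces *)

Lemma has_deriv_normal_surface (R : realType) (I : set R) (gamma v : R -> 'rV[R]_3)
    (p : R * R) : admissible I [:: 1 : R] -> I p.1 ->
  derivable_within I gamma p.1 (1 : R) -> derivable_within I v p.1 (1 : R) ->
  has_deriv (I `*` setT) (normal_surface gamma v) p e_1
    (deriv1 I gamma p.1 + p.2 *: deriv1 I v p.1) /\
  has_deriv (I `*` setT) (normal_surface gamma v) p e_2 (v p.1).
Proof.
move=> IE Ip gd vd; have Up : (I `*` setT) p by [].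
split.
- have := has_derivD (has_deriv_fst (has_deriv_derive gd))
    (has_derivZ Up (has_deriv_snd_e_1 I p) (has_deriv_fst (has_deriv_derive vd))).
  by rewrite scale0r add0r.
- have := has_derivD (has_deriv_fst_e_2 I gamma p)
    (has_derivZ Up (has_deriv_snd_e_2 I p) (has_deriv_fst_e_2 I v p)).
  by rewrite scale1r scaler0 add0r addr0.
Qed.

Theorem proposition3p3 (R : realType) (I : set R)
    (I_interval : is_interval I)
    (I_nondegenerate : exists a b : R, [/\ I a, I b & a < b])
    (gamma nu1 nu2 : R -> 'rV[R]_3)
    (gamma_framed : framed_curve I gamma nu1 nu2)
    (v w mu : R -> 'rV[R]_3)
    (vw_rotated : rotated_frame I nu1 nu2 v w mu)
    (lbar mbar nbar alpha : R -> R)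
    (curvature_vw : is_curvature I gamma v w lbar mbar nbar alpha) :
  (exists n : R * R -> 'rV[R]_3,
      [/\ smooth2 (I `*` setT) n,
          forall p, (I `*` setT) p -> sphere2 (n p) &
          framed_surface (I `*` setT) (normal_surface gamma v) n
            (fun p => v p.1)])
  <->
  (exists phi : R * R -> R,
      smooth2 (I `*` setT) phi /\
      forall t lambda : R, I t ->
        lambda * lbar t * cos (phi (t, lambda))
        - (alpha t + lambda * mbar t) * sin (phi (t, lambda)) = 0).
Proof.
have IE := admissible_interval I_interval I_nondegenerate.
have UE := admissible_product IE.
case: gamma_framed => gammak nu1k nu2k nuD nuT.
case: vw_rotated => [[theta thetak vwE] _].
have vk : smooth1 I v.
  move=> k; have [ck sk] := Ck_cos_sin IE (thetak k).
  have := CkB IE (CkZ IE ck (nu1k k)) (CkZ IE sk (nu2k k)).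
  by apply: Ck_eq => // t It; have [->] := vwE t It.
have wk : smooth1 I w.
  move=> k; have [ck sk] := Ck_cos_sin IE (thetak k).
  have := CkD IE (CkZ IE sk (nu1k k)) (CkZ IE ck (nu2k k)).
  by apply: Ck_eq => // t It; have [_ ->] := vwE t It.
have vwD t : I t -> [/\ dot (v t) (v t) = 1, dot (w t) (w t) = 1 & dot (v t) (w t) = 0].
  by move=> It; have [-> ->] := vwE t It; exact: Delta_rotate (nuD t It).
have gw t : I t -> dot (deriv1 I gamma t) (w t) = 0.
  move=> It; have [_ ->] := vwE t It; have [g1 g2] := nuT t It.
  by rewrite dotC !dot_lin !(dotC _ (deriv1 _ _ _)) g1 g2 !mulr0 addr0.
pose m (p : R * R) := cross (v p.1) (w p.1).
have v2k k : Ck_on k [:: e_1; e_2] (I `*` setT) (fun p : R * R => v p.1) :=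
  Ck_fst IE (vk k).
have w2k k : Ck_on k [:: e_1; e_2] (I `*` setT) (fun p : R * R => w p.1) :=
  Ck_fst IE (wk k).
have mk k : Ck_on k [:: e_1; e_2] (I `*` setT) m := Ck_cross UE (v2k k) (w2k k).
have deriv_mem (f : R -> 'rV[R]_3) t : smooth1 I f -> I t ->
    derivable_within I f t (1 : R).
  by move=> fk It; have [_ /(_ _ (mem_head _ _))[fd _]] := fk 1; exact: fd.
have xE p : (I `*` setT) p ->
    derive_within (I `*` setT) (normal_surface gamma v) p e_1 =
      deriv1 I gamma p.1 + p.2 *: deriv1 I v p.1 /\
    derive_within (I `*` setT) (normal_surface gamma v) p e_2 = v p.1.
  move=> Up; have Ip := Up.1.
  have [d1 d2] := has_deriv_normal_surface IE Ip
    (deriv_mem _ _ gammak Ip) (deriv_mem _ _ vk Ip).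
  by split; [have [] := has_deriv_val (UE _ _ _ Up) d1
            |have [] := has_deriv_val (UE _ _ _ Up) d2]; rewrite ?inE ?eqxx ?orbT.
(* The equation of the statement, for an arbitrary normal in the plane of w
   and mu; it is the only place where the curvature enters. *)
have key p (c s : R) : (I `*` setT) p ->
    dot (deriv1 I gamma p.1 + p.2 *: deriv1 I v p.1) (c *: w p.1 - s *: m p) =
    p.2 * lbar p.1 * c - (alpha p.1 + p.2 * mbar p.1) * s.
  move=> Up; have [lE mE _ aE] := curvature_vw _ Up.1.
  rewrite dotC !dot_lin !(dotC _ (_ + _)) !dot_lin gw ?lE ?mE ?aE; last exact: Up.1.
  rewrite /unit_tangent /m. ring.
split=> [[n [nk n1 [_ _ _ nD nx]]]|[phi [phik phiE]]].
(* The sign of b is that of the convention n = cos phi w - sin phi mu. *)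
- pose a (p : R * R) := dot (n p) (w p.1); pose b (p : R * R) := - dot (n p) (m p).
  have ak k : Ck_on k [:: e_1; e_2] (I `*` setT) a := Ck_dot UE (nk k) (w2k k).
  have bk k : Ck_on k [:: e_1; e_2] (I `*` setT) b := CkN UE (Ck_dot UE (nk k) (mk k)).
  have ab1 p : (I `*` setT) p -> a p ^+ 2 + b p ^+ 2 = 1.
    move=> Up; have [vv ww vw] := vwD _ Up.1; have [/= nn _ nv] := nD p Up.
    have := dot_frame (n p) (n p) vv ww vw.
    by rewrite nn nv => ->; rewrite /a /b /m; ring.
  have [x0 [_ [Ix0 _ _]]] := I_nondegenerate.
  have U0 : (I `*` setT) (x0, 0 : R) by [].
  have star (p : R * R) s : (I `*` setT) p -> 0 <= s <= 1 ->
      (I `*` setT) (ray (x0, 0) s p).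
    move=> [Ip _] /andP[s0 s1]; split=> //=; rewrite -[s *: _]/(s * _).
    have [xp|px] := leP x0 p.1;
      [apply: (I_interval x0 p.1)|apply: (I_interval p.1 x0)] => //.
    + by apply/andP; split; nra.
    + by apply/andP; split; nra.
  have [phi [phic phiE]] :=
    circle_lift star (Ck_continuous (ak 0)) (Ck_continuous (bk 0)) ab1 U0.
  exists phi; split; first exact: Ck_angle phic phiE ak bk.
  move=> t l It; have Up : (I `*` setT) (t, l) by [].
  have [-> ->] := phiE _ Up.
  rewrite -(key (t, l)) //.
  have [/= vv ww vw] := vwD _ It; have [/= nn _ nv] := nD _ Up.
  have [x1 _] := nx _ Up; rewrite (xE _ Up).1 /= in x1.
  rewrite -[RHS]x1; move: (deriv1 I gamma t + _) => X.
  rewrite (dot_frame X (n _) vv ww vw) nv dotC !dot_lin /a /b /m /= !(dotC _ X); ring.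
- pose n p := cos (phi p) *: w p.1 - sin (phi p) *: m p.
  have nk : smooth2 (I `*` setT) n.
    move=> k; have [ck sk] := Ck_cos_sin UE (phik k).
    exact: CkB (CkZ UE ck (w2k k)) (CkZ UE sk (mk k)).
  have nD p : (I `*` setT) p -> Delta (n p, v p.1).
    move=> Up; have [vv ww vw] := vwD _ Up.1.
    have mm : dot (m p) (m p) = 1 := dot_cross_cross vv ww vw.
    have mw : dot (m p) (w p.1) = 0 := dot_cross_r _ _.
    have mv : dot (m p) (v p.1) = 0 := dot_cross_l _ _.
    split=> //; rewrite /sphere2 /= /n.
      rewrite !dot_lin !(dotC _ (_ - _)) !dot_lin (dotC (w _) (m _)) mm mw ww.
      rewrite -[RHS](cos2Dsin2 (phi p)); ring.
    by rewrite !dot_lin mv dotC vw; ring.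
  have gammaSk : smooth2 (I `*` setT) (normal_surface gamma v).
    move=> k; exact: CkD (Ck_fst IE (gammak k)) (CkZ UE (Ck_snd IE k) (v2k k)).
  exists n; split=> // [p /nD[]//|]; split=> // p Up.
  have [-> ->] := xE p Up; rewrite key //; split.
    by case: p Up => t l [It _]; exact: phiE.
  by rewrite dotC; have [] := nD p Up.
Qed.
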